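(* Suppose $p,q\in[1,\infty)$, and either (1) $1\leq p<q\leq2$, or (2) $q=2<p<\infty$. There exists $\varepsilon>0$ such that if a subspace $E\subseteq L_p[0,1]$ is $(1+\varepsilon)$-isomorphic to a subspace $F\subseteq L_q[0,1]$, then $E$ does stable phase retrieval in $L_p[0,1]$.
   Context: All $L_p$-spaces are real. Normed spaces $E$ and $F$ are $c$-isomorphic if there is a linear isomorphism $T:E\to F$ with $\|T\|\,\|T^{-1}\|\leq c$. A subspace $E$ of a real Banach lattice $X$ does stable phase retrieval (SPR) if there is a constant $C$ such that $\min_{\lambda\in\{1,-1\}}\|f-\lambda g\|\leq C\big\||f|-|g|\big\|$ for all $f,g\in E$. *)

(* Defs.v *)
From HB Require Import structures.
From mathcomp Require Import all_boot all_order all_algebra.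
From mathcomp Require Import all_classical all_reals all_analysis.
From mathcomp Require Import measurable_realfun ess_sup_inf.

Set Implicit Arguments.
Unset Strict Implicit.
Unset Printing Implicit Defensive.
Import Order.TTheory GRing.Theory Num.Theory.
Import numFieldNormedType.Exports.

Local Open Scope classical_set_scope.
Local Open Scope ring_scope.
Local Open Scope quotient_scope.

(* The library's [LspaceType mu p1] (functions with a finite p-norm, modulo
   mu-a.e. equality) is a bare type: this section makes it a normed space and
   defines on it the pointwise absolute value of the Banach lattice L_p(mu). *)
Section Lspace_structure.
Context d (T : measurableType d) (R : realType).
Variables (mu : {measure set T -> \bar R}) (p : \bar R) (p1 : (1 <= p)%E).

Notation Lp := (LspaceType mu p1).
Notation quotT := {mfun_ mu, T >-> measurableTypeR R}.

Lemma Lspace_repr_subproof (u : Lp) : (u : T -> R) \in Lfun mu p.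
Proof.
rewrite inE; apply/andP; split; rewrite inE/=; last exact: Lebesgue_finite.
move=> mD Y mY.
exact: (@measurable_funP _ _ _ _ setT (repr (u : quotT)) mD Y mY).
Qed.

Definition Lspace_repr (u : Lp) : LfunType mu p1 :=
  Lfun_Sub p1 (Lspace_repr_subproof u).

Lemma Lspace_reprE (u : Lp) : Lspace_repr u = u :> (T -> R).
Proof. by []. Qed.

Lemma ae_eq_Lnorm (f g : T -> R) :
  measurable_fun setT f -> measurable_fun setT g -> f = g %[ae mu] ->
  ('N[mu]_p[EFin \o f] = 'N[mu]_p[EFin \o g])%E.
Proof.
move=> mf mg fg; rewrite unlock /Lnorm; case: p p1 => //= [r r1|_].
  congr (_ `^ _)%E; apply: ae_eq_integral => //=.
  - apply/measurable_EFinP.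
    apply: (@measurableT_comp _ _ _ _ _ _ (@powR R ^~ r)) => //.
    exact: measurableT_comp.
  - apply/measurable_EFinP.
    apply: (@measurableT_comp _ _ _ _ _ _ (@powR R ^~ r)) => //.
    exact: measurableT_comp.
  - by apply: filterS fg => x /(_ I) fgx _ /=; rewrite fgx.
case: ifP => // _; apply: eq_ess_sup.
by apply: filterS fg => x /(_ I) fgx /=; rewrite fgx.
Qed.

Section class_of.
Variable f : LfunType mu p1.

Lemma Lspace_pi_subproof1 :
  @measurable_fun _ _ T (measurableTypeR R) setT (f : T -> R).
Proof. move=> mD Y mY; exact: (@measurable_funP _ _ _ _ setT f mD Y mY). Qed.

Let mf : {mfun T >-> measurableTypeR R} :=
  HB.pack (f : T -> measurableTypeR R)
    (@isMeasurableFun.Build _ _ T (measurableTypeR R) f Lspace_pi_subproof1).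

Let cf : quotT := \pi_(quotT) mf.

Lemma Lspace_pi_subproof2 : (cf : T -> R) = f %[ae mu].
Proof.
have /eqP : cf = \pi_(quotT) (repr cf) by rewrite reprK.
by rewrite eqmodE => /asboolP/ae_eq_sym.
Qed.

Lemma Lspace_pi_subproof3 : finite_norm mu p cf.
Proof.
rewrite /finite_norm (@ae_eq_Lnorm _ f)//; first exact: Lfunction_finite.
- move=> mD Y mY.
  exact: (@measurable_funP _ _ _ _ setT (repr cf) mD Y mY).
- exact: Lspace_pi_subproof2.
Qed.

Definition Lspace_pi : Lp :=
  HB.pack cf (@isFinLebesgue.Build _ T R mu p p1 cf Lspace_pi_subproof3).

Lemma Lspace_piE : (Lspace_pi : T -> R) = f %[ae mu].
Proof. exact: Lspace_pi_subproof2. Qed.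

End class_of.

Lemma LspaceP (u v : Lp) : (u : T -> R) = v %[ae mu] -> u = v.
Proof.
move=> uv.
have : (u : quotT) = v.
  by rewrite -[u : quotT]reprK -[v : quotT]reprK; apply/eqmodP/asboolP.
case: u v {uv} => [u [[uf]]] [v [[vf]]] /= uv.
by case: _ / uv vf => vf; rewrite (Prop_irrelevance uf vf).
Qed.

HB.instance Definition _ := gen_eqMixin Lp.
HB.instance Definition _ := gen_choiceMixin Lp.

Definition Lspace_zero : Lp := Lspace_pi 0.
Definition Lspace_opp (u : Lp) : Lp := Lspace_pi (- Lspace_repr u).
Definition Lspace_add (u v : Lp) : Lp :=
  Lspace_pi (Lspace_repr u + Lspace_repr v).
Definition Lspace_scale (a : R) (u : Lp) : Lp := Lspace_pi (a *: Lspace_repr u).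

Lemma Lspace_zeroE : (Lspace_zero : T -> R) = cst 0 %[ae mu].
Proof. exact: Lspace_piE. Qed.

Lemma Lspace_oppE u : (Lspace_opp u : T -> R) = (fun x => - u x : R) %[ae mu].
Proof. exact: Lspace_piE. Qed.

Lemma Lspace_addE u v :
  (Lspace_add u v : T -> R) = (fun x => (u x : R) + v x) %[ae mu].
Proof. exact: Lspace_piE. Qed.

Lemma Lspace_scaleE a u :
  (Lspace_scale a u : T -> R) = (fun x => a * (u x : R)) %[ae mu].
Proof. exact: Lspace_piE. Qed.

Let addA : associative Lspace_add.
Proof.
move=> u v w; apply: LspaceP.
have := Lspace_addE u (Lspace_add v w); have := Lspace_addE v w.
have := Lspace_addE (Lspace_add u v) w; have := Lspace_addE u v.
move=> h1 h2 h3 h4.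
apply: filterS (filterI (filterI h1 h2) (filterI h3 h4)).
move=> x [[/(_ I) uv /(_ I) uv_w] [/(_ I) vw /(_ I) ->]] _.
by rewrite vw uv_w uv addrA.
Qed.

Let addC : commutative Lspace_add.
Proof. by move=> u v; rewrite /Lspace_add addrC. Qed.

Let add0 : left_id Lspace_zero Lspace_add.
Proof.
move=> u; apply: LspaceP.
have := Lspace_addE Lspace_zero u; have := Lspace_zeroE.
by apply: filterS2 => x /(_ I) u0 /(_ I) -> _; rewrite u0 add0r.
Qed.

Let addN : left_inverse Lspace_zero Lspace_opp Lspace_add.
Proof.
move=> u; apply: LspaceP.
have := Lspace_addE (Lspace_opp u) u; have := Lspace_oppE u.
have := Lspace_zeroE.
by apply: filterS3 => x /(_ I) -> /(_ I) uN /(_ I) -> _; rewrite uN addNr.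
Qed.

HB.instance Definition _ := GRing.isZmodule.Build Lp addA addC add0 addN.

Let scaleA a b u :
  Lspace_scale a (Lspace_scale b u) = Lspace_scale (a * b) u.
Proof.
apply: LspaceP; have := Lspace_scaleE a (Lspace_scale b u).
have := Lspace_scaleE b u; have := Lspace_scaleE (a * b) u.
by apply: filterS3 => x /(_ I) -> /(_ I) ub /(_ I) -> _; rewrite ub mulrA.
Qed.

Let scale1 : left_id 1 Lspace_scale.
Proof.
move=> u; apply: LspaceP; have := Lspace_scaleE 1 u.
by apply: filterS => x /(_ I) -> _; rewrite mul1r.
Qed.

Let scaleDr : right_distributive Lspace_scale +%R.
Proof.
move=> a u v; apply: LspaceP.
have := Lspace_scaleE a (u + v); have := Lspace_addE u v.
have := Lspace_addE (Lspace_scale a u) (Lspace_scale a v).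
have := Lspace_scaleE a u; have := Lspace_scaleE a v.
move=> h1 h2 h3 h4 h5.
apply: filterS (filterI (filterI h1 h2) (filterI (filterI h3 h4) h5)).
move=> x [[/(_ I) av /(_ I) au] [[/(_ I) adduv /(_ I) uv] /(_ I) ->]] _.
by rewrite [in LHS]uv mulrDr adduv au av.
Qed.

Let scaleDl u : {morph Lspace_scale^~ u : a b / a + b}.
Proof.
move=> a b; apply: LspaceP.
have := Lspace_scaleE (a + b) u; have := Lspace_scaleE a u.
have := Lspace_scaleE b u.
have := Lspace_addE (Lspace_scale a u) (Lspace_scale b u).
move=> h1 h2 h3 h4.
apply: filterS (filterI (filterI h1 h2) (filterI h3 h4)).
move=> x [[/(_ I) ab /(_ I) bu] [/(_ I) au /(_ I) ->]] _.
by rewrite mulrDl ab au bu.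
Qed.

HB.instance Definition _ :=
  GRing.Zmodule_isLmodule.Build R Lp scaleA scale1 scaleDr scaleDl.

Definition Lspace_norm (u : Lp) : R := fine 'N[mu]_p[EFin \o u]%E.

Lemma Lspace_norm_pi (f : LfunType mu p1) :
  Lspace_norm (Lspace_pi f) = fine 'N[mu]_p[EFin \o f]%E.
Proof.
rewrite /Lspace_norm (@ae_eq_Lnorm _ f) //; last exact: Lspace_piE.
exact: (@measurable_funP _ _ _ _ setT (Lspace_repr (Lspace_pi f))).
Qed.

Let normD u v : Lspace_norm (u + v) <= Lspace_norm u + Lspace_norm v.
Proof. by rewrite Lspace_norm_pi; exact: ler_LnormD. Qed.

Let normZ a u : Lspace_norm (a *: u) = `|a| * Lspace_norm u.
Proof.
rewrite Lspace_norm_pi; apply: EFin_inj.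
by rewrite finite_norm_fine LnormZ -finite_norm_fine.
Qed.

Let norm_eq0 u : Lspace_norm u = 0 -> u = 0.
Proof.
move=> u0; apply: LspaceP.
have := @fine_Lnormr_eq0 _ _ _ _ _ p1 (Lspace_repr u) u0.
have := Lspace_zeroE.
by apply: filterS2 => x /(_ I) -> /(_ I).
Qed.

HB.instance Definition _ :=
  Lmodule_isNormed.Build R Lp normD normZ norm_eq0.

Lemma Lspace_normE (u : Lp) : `|u| = fine 'N[mu]_p[EFin \o u]%E.
Proof. by []. Qed.

Lemma Lspace_abs_subproof (f : LfunType mu p1) :
  (fun x => `|f x|) \in Lfun mu p.
Proof.
rewrite inE; apply/andP; split; rewrite inE/=; first exact: measurableT_comp.
rewrite /finite_norm (_ : _ \o _ = abse \o (EFin \o f))// Lnorm_abse.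
exact: Lfunction_finite.
Qed.

Definition Lspace_abs (u : Lp) : Lp :=
  Lspace_pi (Lfun_Sub p1 (Lspace_abs_subproof (Lspace_repr u))).

Lemma Lspace_absE u : (Lspace_abs u : T -> R) = (fun x => `|u x : R|) %[ae mu].
Proof. exact: Lspace_piE. Qed.

End Lspace_structure.

Section linear_subspace.
Context (R : numFieldType) (V : normedModType R).

Definition linear_subspace (E : submodClosed V) := {x : V | x \in E}.

Variable E : submodClosed V.

HB.instance Definition _ := SubType.on (linear_subspace E).
HB.instance Definition _ := [Choice of linear_subspace E by <:].
HB.instance Definition _ :=
  [SubChoice_isSubLmodule of linear_subspace E by <:].

Definition linear_subspace_norm (x : linear_subspace E) : R := `|val x|.

Let normD x y : linear_subspace_norm (x + y) <=
  linear_subspace_norm x + linear_subspace_norm y.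
Proof. exact: ler_normD. Qed.

Let normZ a x : linear_subspace_norm (a *: x) = `|a| * linear_subspace_norm x.
Proof. exact: normrZ. Qed.

Let norm_eq0 x : linear_subspace_norm x = 0 -> x = 0.
Proof. by move=> /normr0_eq0 x0; apply: val_inj. Qed.

HB.instance Definition _ :=
  Lmodule_isNormed.Build R (linear_subspace E) normD normZ norm_eq0.

Lemma linear_subspace_normE (x : linear_subspace E) : `|x| = `|val x|.
Proof. by []. Qed.

End linear_subspace.

(* Operator norm; it is [+oo] when [f] is unbounded. *)
Definition opnorm (R : realType) (V W : normedModType R) (f : V -> W) :
  \bar R := ereal_sup [set `|f x|%:E | x in [set x : V | `|x| <= 1]].

(* The product below is never the junk value [+oo * 0]: if one of the two
   norms is 0 then both spaces are trivial and the other norm is 0 too. *)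
Definition c_isomorphic (R : realType) (c : R) (V W : normedModType R) : Prop :=
  exists (f : {linear V -> W}) (g : {linear W -> V}),
    [/\ cancel f g, cancel g f & (opnorm f * opnorm g <= c%:E)%E].

Definition stable_phase_retrieval d (T : measurableType d) (R : realType)
    (mu : {measure set T -> \bar R}) (p : \bar R) (p1 : (1 <= p)%E)
    (E : submodClosed (LspaceType mu p1)) : Prop :=
  exists C : R, forall f g : LspaceType mu p1, f \in E -> g \in E ->
    Num.min `|f - g| `|f + g| <= C * `| Lspace_abs f - Lspace_abs g |.

Definition lebesgue01 (R : realType) : {measure set (measurableTypeR R) -> \bar R} :=
  mrestr lebesgue_measure
    (measurable_itv `[0, 1] : measurable (`[0, 1] : set (measurableTypeR R))).

(* L_p[0,1]: as the measure is concentrated on [0,1], classes of functions on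
   the line modulo a.e. equality are classes of functions on [0,1]. *)
Definition Lp01 (R : realType) (p : R) (p1 : (1 <= p%:E)%E) :=
  LspaceType (lebesgue01 R) p1.

(* Main.v *)
Require Import Defs.
From HB Require Import structures.
From mathcomp Require Import all_boot all_order all_algebra.
From mathcomp Require Import all_classical all_reals all_analysis.
From mathcomp Require Import measurable_realfun lra.

Set Implicit Arguments.
Unset Strict Implicit.
Unset Printing Implicit Defensive.
Import Order.TTheory GRing.Theory Num.Theory.
Import numFieldNormedType.Exports.

Local Open Scope ring_scope.

(** Stable phase retrieval of [E] holds once [E] contains no almost disjoint
pairs of vectors of equal norm.  Indeed, with [u = f + g] and [v = f - g], the
absolute value of [|f| - |g|] is the pointwise minimum of [|u|] and [|v|], and
shrinking the longer of [u], [v] until the norms agree can only decrease this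
minimum ([stable_phase_retrieval_of_disjoint]).

Let [u], [v] in [L_p] have norm [s], and let [m] dominate the minimum of [|u|]
and [|v|].  If [m] were 0 then [u], [v] would span an isometric copy of the
two-dimensional [l_p], so that [u + v] and [u - v] would have norm
[2 ^ (1/p) * s].  In general this norm is perturbed by at most a multiple of
the norm of [m]: [almost_disjoint_ge] and [almost_disjoint_le].

The two-dimensional [l_p] does not embed almost isometrically into [L_q], as
sums and differences tell them apart:
- for [q <= 2], vectors of norm [s] in [L_q] satisfy the Clarkson inequality
  [|u + v| ^ q + |u - v| ^ q <= 4 * s ^ q], so through a [c]-isomorphism at
  least one of [u + v], [u - v] has norm at most [2 ^ (1/q) * c * s]
  ([c_isomorphic_Clarkson]); if [p < q] and [c] is close to 1 this is
  definitely smaller than [2 ^ (1/p) * s];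
- for [q = 2] the parallelogram law shows in the same way that one of [u + v],
  [u - v] has norm at least [2 ^ (1/2) * s / c] ([c_isomorphic_parallelogram]);
  if [2 < p] and [c] is close to 1 this is definitely larger than
  [2 ^ (1/p) * s].
In both cases [s] is bounded by a multiple of the norm of [m], which is the
absence of almost disjoint pairs, with an explicit constant that depends on
[p], [q] and [c] only. *)

(** * Inequalities between powers of real numbers *)

Section powR_inequalities.
Context (R : realType).
Implicit Types (a b c k p q r t w x y z : R).

Lemma le_powR r x y : 0 <= r -> 0 <= x -> x <= y -> x `^ r <= y `^ r.
Proof.
move=> r0 x0 xy; apply: ge0_ler_powR => //; rewrite nnegrE//.
exact: le_trans xy.
Qed.

Lemma powR_invK r x : r != 0 -> 0 <= x -> (x `^ r) `^ r^-1 = x.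
Proof. by move=> r0 x0; rewrite -powRrM mulfV// powRr1. Qed.

Lemma powRV_K r x : r != 0 -> 0 <= x -> (x `^ r^-1) `^ r = x.
Proof. by move=> r0 x0; rewrite -powRrM mulVf// powRr1. Qed.

Lemma le_root_powR r k x y : 0 < r -> 0 <= k -> 0 <= x -> 0 <= y ->
  x `^ r <= k * y `^ r -> x <= k `^ r^-1 * y.
Proof.
move=> r0 k0 x0 y0 xy.
have rN0 : r != 0 by rewrite gt_eqF.
rewrite -[x in x <= _](powR_invK rN0 x0) -[y in _ <= _ * y](powR_invK rN0 y0).
rewrite -powRM ?powR_ge0//; apply: le_powR xy; rewrite ?powR_ge0//.
by rewrite invr_ge0 ltW.
Qed.

Lemma le_powR_root r k x y : 0 < r -> 0 <= k -> 0 <= x -> 0 <= y ->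
  k * x `^ r <= y `^ r -> k `^ r^-1 * x <= y.
Proof.
move=> r0 k0 x0 y0 xy.
have rN0 : r != 0 by rewrite gt_eqF.
rewrite -[x in _ * x <= _](powR_invK rN0 x0) -[y in _ <= y](powR_invK rN0 y0).
rewrite -powRM ?powR_ge0//; apply: le_powR xy; rewrite ?mulr_ge0 ?powR_ge0//.
by rewrite invr_ge0 ltW.
Qed.

(** With [t = a / (a + b)], this is [t ^ p + (1 - t) ^ p <= t + (1 - t)]. *)
Lemma powR_superadditive p a b : 1 <= p -> 0 <= a -> 0 <= b ->
  a `^ p + b `^ p <= (a + b) `^ p.
Proof.
move=> p1; have p0 : 0 < p by lra.
wlog : / 0 < a + b => [hw a0 b0|ab0 a0 b0].
  have [//|ab0] := ltP 0 (a + b); first by move=> ?; exact: hw.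
  have -> : a = 0 by lra.
  have -> : b = 0 by lra.
  by rewrite addr0 powR0 ?addr0// gt_eqF.
have frac t : 0 <= t -> t <= a + b -> (t / (a + b)) `^ p <= t / (a + b).
  rewrite le_eqVlt => /orP[/eqP <- _|t0 tab].
    by rewrite mul0r powR0// gt_eqF.
  apply: ge1r_powR => //; rewrite divr_gt0//=.
  by rewrite ler_pdivrMr// mul1r.
have split t : 0 <= t -> t `^ p = (t / (a + b)) `^ p * (a + b) `^ p.
  by move=> t0; rewrite -powRM ?divr_ge0// ?ltW// divfK// gt_eqF.
rewrite (split a)// (split b)// -mulrDl ler_piMl ?powR_ge0//.
have -> : 1 = a / (a + b) + b / (a + b) :> R.
  by rewrite -mulrDl divff// gt_eqF.
by apply: lerD; apply: frac => //; lra.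
Qed.

(** Superadditivity of the power [1 / r], applied to [a ^ r] and [b ^ r]. *)
Lemma powR_subadditive r a b : 0 < r <= 1 -> 0 <= a -> 0 <= b ->
  (a + b) `^ r <= a `^ r + b `^ r.
Proof.
move=> /andP[r0 r1] a0 b0; have rN0 : r != 0 by rewrite gt_eqF.
have V1 : 1 <= r^-1 by rewrite invf_ge1.
have := powR_superadditive V1 (powR_ge0 a r) (powR_ge0 b r).
rewrite !powR_invK// => /(le_powR (ltW r0) (addr_ge0 a0 b0)).
by rewrite powRV_K// addr_ge0 ?powR_ge0.
Qed.

(** Convexity of the power [1 / r], applied to [a ^ r] and [b ^ r]. *)
Lemma powR_midpoint_concave r a b : 0 < r <= 1 -> 0 <= a -> 0 <= b ->
  a `^ r + b `^ r <= 2 * ((a + b) / 2) `^ r.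
Proof.
move=> /andP[r0 r1] a0 b0; have rN0 : r != 0 by rewrite gt_eqF.
have V1 : 1 <= r^-1 by rewrite invf_ge1.
have hc : (2^-1 * a `^ r + 2^-1 * b `^ r) `^ r^-1 <= 2^-1 * a + 2^-1 * b.
  rewrite -{2}(powR_invK rN0 a0) -{2}(powR_invK rN0 b0).
  rewrite {2 4}(_ : 2^-1 = 1 - 2^-1); last by lra.
  apply: (convex_powR V1 (Itv01 _ _)) => //=;
    rewrite ?inE/= ?in_itv/= ?powR_ge0//; lra.
have hs : 0 <= 2^-1 * a `^ r + 2^-1 * b `^ r.
  by rewrite addr_ge0 ?mulr_ge0 ?powR_ge0// invr_ge0.
have := le_powR (ltW r0) (powR_ge0 _ _) hc.
rewrite powRV_K// (_ : 2^-1 * a + 2^-1 * b = (a + b) / 2); lra.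
Qed.

(** The easy Clarkson inequality.  The squares of [a + b] and [a - b] have mean
[a ^ 2 + b ^ 2], so concavity of the power [q / 2] bounds the left-hand side by
[2 * (a ^ 2 + b ^ 2) ^ (q / 2)], and subadditivity of that power concludes. *)
Lemma Clarkson_real q a b : 0 < q <= 2 ->
  `|a + b| `^ q + `|a - b| `^ q <= 2 * (`|a| `^ q + `|b| `^ q).
Proof.
move=> /andP[q0 q2].
have hq2 : 0 < q / 2 <= 1 by apply/andP; split; lra.
have sqr x : `|x| `^ q = (x ^+ 2) `^ (q / 2).
  rewrite -[x ^+ 2]real_normK ?num_real// -powR_mulrn// -powRrM.
  by congr (_ `^ _); rewrite mulrC divfK.
rewrite !sqr.
apply: le_trans (powR_midpoint_concave hq2 (sqr_ge0 _) (sqr_ge0 _)) _.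
have -> : ((a + b) ^+ 2 + (a - b) ^+ 2) / 2 = a ^+ 2 + b ^+ 2.
  by rewrite sqrrD sqrrB; lra.
by rewrite ler_pM2l// powR_subadditive ?sqr_ge0.
Qed.

Lemma max_norm_half_sum a b :
  Num.max `|a| `|b| = 2^-1 * (`|a + b| + `|a - b|).
Proof.
by case: (leP `|a| `|b|); case: (ger0P a); case: (ger0P b);
  case: (ger0P (a + b)); case: (ger0P (a - b)); lra.
Qed.

Lemma add_norm_le_min a b c :
  Num.min `|a| `|b| <= c -> `|a| + `|b| <= `|a + b| + 2 * c.
Proof.
by case: (leP `|a| `|b|); case: (ger0P a); case: (ger0P b);
  case: (ger0P (a + b)); lra.
Qed.

Lemma min_norm_le_norm_sub_abs a b :
  Num.min `|a + b| `|a - b| <= `| `|a| - `|b| |.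
Proof.
by case: (leP `|a + b| `|a - b|); case: (ger0P (`|a| - `|b|));
  case: (ger0P a); case: (ger0P b);
  case: (ger0P (a + b)); case: (ger0P (a - b)); lra.
Qed.

(** How an inequality between sums of two terms passes from one space to
another: [a <= b * x] and [z <= w] are the bounds of the maps between the spaces,
and averaging over the two terms leaves one of them on each side. *)
Lemma le_of_sum_le k a b x y z t w : 0 <= k -> 0 <= b ->
  a <= b * x -> a <= b * y -> x + y <= k * (z + t) -> z <= w -> t <= w ->
  a <= k * (b * w).
Proof.
move=> k0 b0 ax ay xyzt zw tw.
have zt : k * (z + t) <= k * (w + w) by rewrite ler_wpM2l// lerD.
have := ler_wpM2l b0 (le_trans xyzt zt); lra.
Qed.

End powR_inequalities.

(** * Pointwise inequalities and norms in [L_r] *)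

Section Lspace_norm_comparison.
Context d (T : measurableType d) (R : realType).
Context (mu : {measure set T -> \bar R}).
Context (r : R) (r1 : (1 <= r%:E)%E).
Notation Lr := (LspaceType mu r1).
Implicit Types u v w m : Lr.

Lemma Lspace_exponent_gt0 : 0 < r.
Proof. by move: r1; rewrite lee_fin; apply: lt_le_trans. Qed.

Lemma measurable_Lspace_powR u :
  measurable_fun setT (fun x => `|u x : R| `^ r).
Proof.
apply: (@measurableT_comp _ _ _ _ _ _ (@powR R ^~ r)) => //.
exact: measurableT_comp.
Qed.

Lemma Lspace_norm_powR u :
  (`|u| `^ r)%:E = (\int[mu]_x (`|u x : R| `^ r)%:E)%E.
Proof.
have fu : 'N[mu]_(r%:E)[EFin \o u]%E \is a fin_num.
  rewrite ge0_fin_numE ?Lnorm_ge0//.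
  exact: (@Lfunction_finite _ _ _ _ _ r1 (Lspace_repr u)).
rewrite Lspace_normE -poweR_EFin fineK// poweR_Lnorm//.
by rewrite gt_eqF// Lspace_exponent_gt0.
Qed.

(** The [r]-th power of the norm is an integral, so an almost everywhere
inequality between [r]-th powers passes to norms.  Monotonicity of the norm, the
Clarkson inequality, the parallelogram law and the estimates for almost disjoint
pairs all come from this lemma; those with fewer terms are obtained by repeating
a vector or by taking one to be 0. *)
Lemma ae_ler_Lspace_norm_powR u v w m k : 0 <= k ->
  (\forall x \ae mu, `|u x : R| `^ r + `|v x : R| `^ r <=
                    k * (`|w x : R| `^ r + `|m x : R| `^ r)) ->
  `|u| `^ r + `|v| `^ r <= k * (`|w| `^ r + `|m| `^ r).
Proof.
move=> k0 uvwm.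
have meas x := measurable_Lspace_powR x.
have split (y z : Lr) : (`|y| `^ r + `|z| `^ r)%:E =
    (\int[mu]_x (`|y x : R| `^ r + `|z x : R| `^ r)%:E)%E.
  by rewrite EFinD !Lspace_norm_powR -ge0_integralD//; exact/measurable_EFinP.
have mfD (y z : Lr) : measurable_fun setT
    (fun x => (`|y x : R| `^ r + `|z x : R| `^ r)%:E).
  by apply/measurable_EFinP/measurable_funD.
have powD_ge0 (y z : Lr) x : (0 <= (`|y x : R| `^ r + `|z x : R| `^ r)%:E)%E.
  by rewrite lee_fin addr_ge0 ?powR_ge0.
rewrite -lee_fin EFinM !split -ge0_integralZl_EFin//.
apply: ae_ge0_le_integral => //.
- by move=> x _; rewrite mule_ge0 ?lee_fin.
- exact: measurable_funeM.
- by apply: filterS uvwm => x h _; rewrite -EFinM lee_fin.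
Qed.

End Lspace_norm_comparison.

(** * Sums and differences in [L_r] *)

Section Lspace_inequalities.
Context d (T : measurableType d) (R : realType).
Context (mu : {measure set T -> \bar R}).
Context (r : R) (r1 : (1 <= r%:E)%E).
Notation Lr := (LspaceType mu r1).
Implicit Types u v w m : Lr.

Let r_ge1 : 1 <= r. Proof. by move: r1; rewrite lee_fin. Qed.
Let r_gt0 : 0 < r. Proof. exact: lt_le_trans r_ge1. Qed.

Lemma Lspace_subE u v : (u - v : T -> R) = (fun x => (u x : R) - v x) %[ae mu].
Proof.
have := Lspace_addE u (- v); have := Lspace_oppE v.
by apply: filterS2 => x /(_ I) hv /(_ I) huv _; rewrite [LHS]huv hv.
Qed.

Lemma ae_ler_Lspace_norm u v :
  (\forall x \ae mu, `|u x : R| <= `|v x : R|) -> `|u| <= `|v|.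
Proof.
move=> uv.
have h : `|u| `^ r + `|u| `^ r <= 1 * (`|v| `^ r + `|v| `^ r).
  apply: ae_ler_Lspace_norm_powR => //; apply: filterS uv => x h.
  by rewrite mul1r lerD// le_powR// ltW.
have -> : `|v| = 1 `^ r^-1 * `|v| by rewrite powR1 mul1r.
by apply: le_root_powR => //; move: h; lra.
Qed.

Lemma norm_Lspace_abs u : `|Lspace_abs u| = `|u|.
Proof.
apply/eqP; rewrite eq_le; apply/andP; split; apply: ae_ler_Lspace_norm;
  by apply: filterS (Lspace_absE u) => x /(_ I) ->; rewrite normr_id.
Qed.

Lemma Clarkson_Lspace u v : r <= 2 ->
  `|u + v| `^ r + `|u - v| `^ r <= 2 * (`|u| `^ r + `|v| `^ r).
Proof.
move=> r2; apply: ae_ler_Lspace_norm_powR => //.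
apply: filterS2 (Lspace_addE u v) (Lspace_subE u v) => x /(_ I) -> /(_ I) ->.
by apply: Clarkson_real; rewrite r_gt0.
Qed.

Lemma parallelogram_Lspace u v : r = 2 ->
  2 * (`|u| `^ r + `|v| `^ r) <= `|u + v| `^ r + `|u - v| `^ r.
Proof.
move=> r2; rewrite -ler_pdivlMl//; apply: ae_ler_Lspace_norm_powR => //.
apply: filterS2 (Lspace_addE u v) (Lspace_subE u v) => x /(_ I) -> /(_ I) ->.
have sqr (y : R) : `|y| `^ r = y ^+ 2.
  by rewrite r2 powR_mulrn// real_normK ?num_real.
rewrite !sqr; lra.
Qed.

(** Pointwise, [|u| + |v| <= |u + v| + 2 * |m|], while superadditivity of the
[r]-th power bounds [|u| ^ r + |v| ^ r] by [(|u| + |v|) ^ r]; the triangle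
inequality in [L_r] then splits the right-hand side. *)
Lemma almost_disjoint_ge u v m :
  (\forall x \ae mu, Num.min `|u x : R| `|v x : R| <= `|m x : R|) ->
  `|u| `^ r + `|v| `^ r <= (`|u + v| + 2 * `|m|) `^ r.
Proof.
move=> uvm.
pose w := Lspace_abs (u + v) + 2 *: Lspace_abs m.
have hw : `|u| `^ r + `|v| `^ r <= 1 * (`|w| `^ r + `|0 : Lr| `^ r).
  apply: ae_ler_Lspace_norm_powR => //.
  apply: filterS (filterI (filterI (filterI (Lspace_addE u v) uvm)
    (filterI (Lspace_absE (u + v)) (Lspace_absE m))) (filterI
    (filterI (Lspace_addE (Lspace_abs (u + v)) (2 *: Lspace_abs m))
      (Lspace_scaleE 2 (Lspace_abs m))) (Lspace_zeroE mu r1))).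
  move=> x [[[/(_ I) uv uvmx] [/(_ I) auv /(_ I) am]]
            [[/(_ I) wE /(_ I) am2] /(_ I) z0]].
  rewrite mul1r [X in _ <= _ + X](_ : _ = 0) ?addr0; last first.
    by rewrite (_ : (0 : Lr) x = 0 :> R)// normr0 powR0// gt_eqF.
  apply: (le_trans (powR_superadditive _ _ _)) => //.
  apply: le_powR; rewrite ?addr_ge0// ?(ltW r_gt0)//.
  rewrite (_ : w x = `|u x + v x : R| + 2 * `|m x : R| :> R); last first.
    by rewrite [LHS]wE am2 am auv uv.
  rewrite [leRHS]ger0_norm ?addr_ge0 ?mulr_ge0//.
  exact: add_norm_le_min.
move: hw; rewrite mul1r normr0 powR0 ?gt_eqF// addr0 => /le_trans; apply.
apply: le_powR; rewrite ?(ltW r_gt0)//.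
rewrite (le_trans (ler_normD _ _))// normrZ !norm_Lspace_abs.
by rewrite ger0_norm.
Qed.

(** Pointwise, [|u + v| <= max |u| |v| + |m|], and the maximum [w] satisfies
[w ^ r <= |u| ^ r + |v| ^ r]. *)
Lemma almost_disjoint_le u v m :
  (\forall x \ae mu, Num.min `|u x : R| `|v x : R| <= `|m x : R|) ->
  `|u + v| <= (`|u| `^ r + `|v| `^ r) `^ r^-1 + `|m|.
Proof.
move=> uvm.
(* The lattice supremum of |u| and |v|, written with absolute values only. *)
pose w := 2^-1 *: (Lspace_abs (u + v) + Lspace_abs (u - v)).
have wE : (w : T -> R) = (fun x => Num.max `|u x : R| `|v x : R|) %[ae mu].
  apply: filterS (filterI (filterI (Lspace_addE u v) (Lspace_subE u v))
    (filterI (filterI (Lspace_absE (u + v)) (Lspace_absE (u - v)))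
    (filterI (Lspace_addE (Lspace_abs (u + v)) (Lspace_abs (u - v)))
      (Lspace_scaleE 2^-1 (Lspace_abs (u + v) + Lspace_abs (u - v)))))).
  move=> x [[/(_ I) uv /(_ I) ub] [[/(_ I) auv /(_ I) aub]
      [/(_ I) sE /(_ I) wE]]] _.
  rewrite [LHS]wE sE auv aub uv ub.
  by rewrite max_norm_half_sum.
have hw : `|w| `^ r + `|0 : Lr| `^ r <= 1 * (`|u| `^ r + `|v| `^ r).
  apply: ae_ler_Lspace_norm_powR => //.
  apply: filterS2 wE (Lspace_zeroE mu r1) => x /(_ I) -> /(_ I) z0.
  rewrite mul1r [X in _ + X](_ : _ = 0) ?addr0; last first.
    by rewrite (_ : (0 : Lr) x = 0 :> R)// normr0 powR0// gt_eqF.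
  rewrite ger0_norm ?le_max ?normr_ge0//.
  by case: (leP `|u x : R| `|v x : R|); rewrite ?lerDl ?lerDr powR_ge0.
have {}hw : `|w| <= (`|u| `^ r + `|v| `^ r) `^ r^-1.
  rewrite -[`|w|](@powR_invK _ r) ?gt_eqF//.
  apply: le_powR; rewrite ?powR_ge0 ?invr_ge0 ?(ltW r_gt0)//.
  by move: hw; rewrite mul1r; apply: le_trans; rewrite lerDl powR_ge0.
apply: le_trans (lerD hw (lexx _)).
rewrite -[`|m|]norm_Lspace_abs; apply: le_trans (ler_normD _ _).
apply: ae_ler_Lspace_norm.
apply: filterS (filterI (filterI (Lspace_addE u v) uvm) (filterI wE
  (filterI (Lspace_absE m) (Lspace_addE w (Lspace_abs m))))).
move=> x [[/(_ I) uv uvmx] [/(_ I) wEx [/(_ I) am /(_ I) wm]]].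
rewrite uv [X in _ <= `|X|]wm am wEx.
rewrite [leRHS]ger0_norm ?addr_ge0 ?le_max ?normr_ge0//.
apply: le_trans (ler_normD _ _) _; rewrite -addr_max_min.
by rewrite lerD2l.
Qed.

(** Lets the two estimates above be applied to [u - v] as well as [u + v]. *)
Lemma ae_min_norm_oppr u v m :
  (\forall x \ae mu, Num.min `|u x : R| `|v x : R| <= `|m x : R|) ->
  \forall x \ae mu, Num.min `|u x : R| `|(- v) x : R| <= `|m x : R|.
Proof.
move=> uvm.
by apply: filterS2 uvm (Lspace_oppE v) => x h /(_ I) ->; rewrite normrN.
Qed.

End Lspace_inequalities.

(** * Phase retrieval and almost disjoint pairs *)

Lemma ae_min_norm_abs_sub d (T : measurableType d) (R : realType)
    (mu : {measure set T -> \bar R}) (r : R) (r1 : (1 <= r%:E)%E)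
    (f g : LspaceType mu r1) :
  \forall x \ae mu, Num.min `|(f + g) x : R| `|(f - g) x : R| <=
                   `|(Lspace_abs f - Lspace_abs g) x : R|.
Proof.
apply: filterS (filterI (filterI (Lspace_addE f g) (Lspace_subE f g))
  (filterI (Lspace_subE (Lspace_abs f) (Lspace_abs g))
    (filterI (Lspace_absE f) (Lspace_absE g)))).
move=> x [[/(_ I) -> /(_ I) ->] [/(_ I) -> [/(_ I) -> /(_ I) ->]]].
exact: min_norm_le_norm_sub_abs.
Qed.

Section almost_disjoint_pairs.
Context d (T : measurableType d) (R : realType).
Context (mu : {measure set T -> \bar R}).
Context (r : R) (r1 : (1 <= r%:E)%E).
Notation Lr := (LspaceType mu r1).

(** The vectors [f + g] and [f - g] need not have the same norm, whereas the
hypothesis speaks of pairs of equal norm only: the longer vector is multiplied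
by some [t <= 1], which keeps the minimum below [|m|]. *)
Lemma stable_phase_retrieval_of_disjoint (E : submodClosed Lr) (C : R) :
  0 <= C ->
  (forall u v m : Lr, u \in E -> v \in E -> `|u| = `|v| ->
    (\forall x \ae mu, Num.min `|u x : R| `|v x : R| <= `|m x : R|) ->
    `|u| <= C * `|m|) ->
  stable_phase_retrieval E.
Proof.
move=> C0 hC; exists C => f g fE gE.
have uE : f + g \in E by rewrite rpredD.
have vE : f - g \in E by rewrite -scaleN1r rpredD// rpredZ.
have := ae_min_norm_abs_sub f g.
move: (f + g) (f - g) (Lspace_abs f - Lspace_abs g) uE vE => u v m uE vE.
rewrite minC; wlog uv : u v uE vE / `|u| <= `|v| => [hw|] uvm.
  have [uv|/ltW vu] := leP `|u| `|v|.
    by have := hw _ _ uE vE uv uvm; rewrite min_l.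
  have := hw _ _ vE uE vu; rewrite min_l//; apply.
  by apply: filterS uvm => x; rewrite minC.
rewrite min_l//.
have [u0|u0] := eqVneq `|u| 0; first by rewrite u0 mulr_ge0.
have nu : 0 < `|u| by rewrite lt_neqAle eq_sym u0 normr_ge0.
have nv : 0 < `|v| := lt_le_trans nu uv.
pose t := `|u| / `|v|.
have t0 : 0 <= t by rewrite divr_ge0.
have t1 : t <= 1 by rewrite ler_pdivrMr// mul1r.
apply: (hC u (t *: v)) => //; first by rewrite rpredZ.
  by rewrite normrZ ger0_norm// divfK// gt_eqF.
apply: filterS2 uvm (Lspace_scaleE t v) => x uvm /(_ I) ->.
apply: le_trans uvm; rewrite le_min ge_min lexx/= ge_min; apply/orP; right.
by rewrite normrM (ger0_norm t0) ler_piMl.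
Qed.

End almost_disjoint_pairs.

(** * Two-sided bounds from a [c]-isomorphism *)

Section opnorm.
Context (R : realType).

Lemma opnorm_ge0 (V W : normedModType R) (f : {linear V -> W}) :
  (0 <= opnorm f)%E.
Proof.
apply: ereal_sup_ubound; exists 0 => /=; first by rewrite normr0.
by rewrite linear0 normr0.
Qed.

Lemma le_opnorm (V W : normedModType R) (f : {linear V -> W}) x :
  (`|f x|%:E <= opnorm f * `|x|%:E)%E.
Proof.
have [->|x0] := eqVneq x 0; first by rewrite linear0 !normr0 mule0.
have nx0 : 0 < `|x| by rewrite normr_gt0.
rewrite -lee_pdivrMr// -EFinM; apply: ereal_sup_ubound.
exists (`|x|^-1 *: x) => /=.
  by rewrite normrZ normfV normr_id mulVf// gt_eqF.
by rewrite linearZ/= normrZ normfV normr_id mulrC.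
Qed.

(** A nonzero vector of [V] makes both operator norms positive; their product
being bounded, both are then finite, and can serve as [A] and [B]. *)
Lemma c_isomorphic_bounds (c : R) (V W : normedModType R) (x0 : V) :
  x0 != 0 -> c_isomorphic c V W ->
  exists (f : {linear V -> W}) (A B : R), [/\ 0 <= A, 0 <= B, A * B <= c,
    forall x, `|f x| <= A * `|x| & forall x, `|x| <= B * `|f x|].
Proof.
move=> x0N0 [f [g [fK gK fgc]]].
have fx0N0 : f x0 != 0.
  by apply: contra x0N0 => /eqP fx0; rewrite -(fK x0) fx0 linear0.
have f0 : (0 < opnorm f)%E.
  rewrite lt_neqAle opnorm_ge0 andbT eq_sym; apply/eqP => f0.
  by have := le_opnorm f x0; rewrite f0 mul0e lee_fin normr_le0 (negPf fx0N0).
have g0 : (0 < opnorm g)%E.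
  rewrite lt_neqAle opnorm_ge0 andbT eq_sym; apply/eqP => g0.
  have := le_opnorm g (f x0).
  by rewrite fK g0 mul0e lee_fin normr_le0 (negPf x0N0).
have ffin : opnorm f \is a fin_num.
  rewrite fin_numElt (lt_trans _ f0) ?ltNy0//= ltey; apply/eqP => fy.
  by move: fgc; rewrite fy gt0_mulye.
have gfin : opnorm g \is a fin_num.
  rewrite fin_numElt (lt_trans _ g0) ?ltNy0//= ltey; apply/eqP => gy.
  by move: fgc; rewrite gy gt0_muley.
exists f, (fine (opnorm f)), (fine (opnorm g)); split.
- exact/fine_ge0/ltW.
- exact/fine_ge0/ltW.
- by rewrite -lee_fin EFinM !fineK.
- by move=> x; rewrite -lee_fin EFinM fineK// le_opnorm.
- by move=> x; rewrite -{1}(fK x) -lee_fin EFinM fineK// le_opnorm.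
Qed.

End opnorm.

(** * Subspaces of [L_p] that are isomorphic to subspaces of [L_q] *)

Section isomorphic_to_Lspace.
Context d1 (T1 : measurableType d1) d2 (T2 : measurableType d2) (R : realType).
Context (mu1 : {measure set T1 -> \bar R}) (mu2 : {measure set T2 -> \bar R}).
Context (p q : R) (p1 : (1 <= p%:E)%E) (q1 : (1 <= q%:E)%E).
Context (E : submodClosed (LspaceType mu1 p1)).
Context (F : submodClosed (LspaceType mu2 q1)) (c : R).
Implicit Types u v : LspaceType mu1 p1.

Let q_gt0 : 0 < q. Proof. exact: Lspace_exponent_gt0 q1. Qed.

(** Transports the Clarkson inequality of [L_q] to [E]: it limits how long
[u + v] and [u - v] can both be. *)
Lemma c_isomorphic_Clarkson u v s a : 0 <= c ->
  c_isomorphic c (linear_subspace E) (linear_subspace F) -> q <= 2 ->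
  u \in E -> v \in E -> `|u| = s -> `|v| = s ->
  a <= `|u + v| -> a <= `|u - v| -> a <= 2 `^ q^-1 * c * s.
Proof.
move=> c0 EF q2 uE vE us vs a1 a2.
have s0 : 0 <= s by rewrite -us.
have [a0|a0] := ltP a 0.
  by rewrite (le_trans (ltW a0))// !mulr_ge0 ?powR_ge0.
have [u0|uN0] := eqVneq u 0.
  by apply: (le_trans a1); rewrite u0 add0r vs -us u0 normr0 mulr0.
pose U : linear_subspace E := exist _ u uE.
pose V : linear_subspace E := exist _ v vE.
have UN0 : U != 0 by apply: contra uN0 => /eqP/(congr1 val)/= ->.
have [f [A [B [A0 B0 AB fA fB]]]] := c_isomorphic_bounds UN0 EF.
have a1' : a <= B * `|val (f U) + val (f V)|.
  by apply: le_trans a1 _; have := fB (U + V); rewrite linearD.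
have a2' : a <= B * `|val (f U) - val (f V)|.
  by apply: le_trans a2 _; have := fB (U - V); rewrite linearB.
have cl := Clarkson_Lspace (val (f U)) (val (f V)) q2.
have fU : `|val (f U)| <= A * s by have := fA U; rewrite -us.
have fV : `|val (f V)| <= A * s by have := fA V; rewrite -vs.
apply: (@le_trans _ _ (2 `^ q^-1 * (A * B * s))); last first.
  by rewrite -[leRHS]mulrA ler_wpM2l ?powR_ge0// ler_wpM2r.
apply: le_root_powR => //; first by rewrite !mulr_ge0.
rewrite (mulrC A) -mulrA powRM// ?mulr_ge0//.
have le_powq := @le_powR _ q _ _ (ltW q_gt0).
by apply: (le_of_sum_le _ _ _ _ cl); rewrite -?powRM// ?powR_ge0// le_powq.
Qed.

(** Transports the parallelogram law to [E]: it limits how short [u + v] and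
[u - v] can both be. *)
Lemma c_isomorphic_parallelogram u v s b : 0 <= c ->
  c_isomorphic c (linear_subspace E) (linear_subspace F) -> q = 2 ->
  u \in E -> v \in E -> `|u| = s -> `|v| = s ->
  `|u + v| <= b -> `|u - v| <= b -> 2 `^ q^-1 * s <= c * b.
Proof.
move=> c0 EF q2 uE vE us vs b1 b2.
have s0 : 0 <= s by rewrite -us.
have b0 : 0 <= b := le_trans (normr_ge0 _) b1.
have [u0|uN0] := eqVneq u 0.
  by rewrite -us u0 normr0 mulr0 mulr_ge0.
pose U : linear_subspace E := exist _ u uE.
pose V : linear_subspace E := exist _ v vE.
have UN0 : U != 0 by apply: contra uN0 => /eqP/(congr1 val)/= ->.
have [f [A [B [A0 B0 AB fA fB]]]] := c_isomorphic_bounds UN0 EF.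
have b1' : `|val (f U) + val (f V)| <= A * b.
  by apply: le_trans (ler_wpM2l A0 b1); have := fA (U + V); rewrite linearD.
have b2' : `|val (f U) - val (f V)| <= A * b.
  by apply: le_trans (ler_wpM2l A0 b2); have := fA (U - V); rewrite linearB.
have cl := parallelogram_Lspace (val (f U)) (val (f V)) q2.
have fU : s <= B * `|val (f U)| by have := fB U; rewrite -us.
have fV : s <= B * `|val (f V)| by have := fB V; rewrite -vs.
apply: (@le_trans _ _ (A * B * b)); last by rewrite ler_wpM2r.
apply: le_powR_root => //; first by rewrite !mulr_ge0.
rewrite (mulrC A) -mulrA powRM// ?mulr_ge0// -ler_pdivlMl//.
rewrite -ler_pdivlMl// in cl.
have le_powq := @le_powR _ q _ _ (ltW q_gt0).
by apply: (le_of_sum_le _ _ _ _ cl); rewrite -?powRM// ?powR_ge0// le_powq.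
Qed.

End isomorphic_to_Lspace.

Lemma exists_dilation_lt (R : realType) (x y : R) : 0 < x -> x < y ->
  exists eps : R, 0 < eps /\ (1 + eps) * x < y.
Proof.
move=> x0 xy.
(* Then 1 + eps is the midpoint of 1 and y / x. *)
exists ((y / x - 1) / 2).
have yx : 1 < y / x by rewrite ltr_pdivlMr// mul1r.
split; first by lra.
by rewrite -ltr_pdivlMr//; lra.
Qed.

Theorem proposition4p1 (R : realType) (p q : R)
    (p1 : (1 <= p%:E)%E) (q1 : (1 <= q%:E)%E)
    (hpq : (1 <= p /\ p < q /\ q <= 2) \/ (q = 2 /\ 2 < p)) :
  exists eps : R, 0 < eps /\
    forall (E : submodClosed (Lp01 p1)) (F : submodClosed (Lp01 q1)),
      c_isomorphic (1 + eps) (linear_subspace E) (linear_subspace F) ->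
      stable_phase_retrieval E.
Proof.
have p0 : 0 < p := Lspace_exponent_gt0 p1.
have q0 : 0 < q := Lspace_exponent_gt0 q1.
have pow2_lt (a b : R) : 0 < a -> a < b -> (2 : R) `^ b^-1 < 2 `^ a^-1.
  move=> a0 ab; rewrite -(ltr_ln (powR_gt0 _ _) (powR_gt0 _ _))// !ln_powR.
  rewrite ltr_pM2r ?ln_gt0 ?ltr1n//.
  by rewrite ltf_pV2// posrE// (lt_trans a0).
have root2 s : 0 <= s -> (s `^ p + s `^ p) `^ p^-1 = 2 `^ p^-1 * s.
  move=> s0; have -> : s `^ p + s `^ p = 2 * s `^ p by lra.
  by rewrite powRM ?powR_ge0// powR_invK// gt_eqF.
case: hpq => [[_ [pq q2]]|[q2 p2]].
- have [eps [eps0 lt]] := exists_dilation_lt (powR_gt0 q^-1 (ltr0n R 2))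
    (pow2_lt _ _ p0 pq).
  exists eps; split=> // E F EF.
  have c0 : 0 <= 1 + eps by lra.
  have D0 : 0 < 2 `^ p^-1 - (1 + eps) * 2 `^ q^-1 by rewrite subr_gt0.
  (* The denominator is the gap between the lower bound for the norms of the
     sum and the difference in L_p and the upper bound inherited from L_q. *)
  apply: (@stable_phase_retrieval_of_disjoint _ _ _ _ _ _ _
    (2 / (2 `^ p^-1 - (1 + eps) * 2 `^ q^-1))); first by rewrite divr_ge0// ltW.
  move=> u v m uE vE uv uvm.
  have uvm' := ae_min_norm_oppr uvm.
  have h1 := almost_disjoint_ge uvm; have h2 := almost_disjoint_ge uvm'.
  rewrite normrN in h2.
  have lower w : 0 <= w -> `|u| `^ p + `|v| `^ p <= w `^ p ->
      2 `^ p^-1 * `|u| <= w.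
    by move=> w0; rewrite -uv => h; apply: le_powR_root => //; lra.
  have sum_ge0 (x : Lp01 p1) : 0 <= `|x| + 2 * `|m|.
    by rewrite addr_ge0 ?mulr_ge0.
  move/(lower _ (sum_ge0 _)): h1 => h1; move/(lower _ (sum_ge0 _)): h2 => h2.
  have := @c_isomorphic_Clarkson _ _ _ _ _ _ _ _ _ _ _ _ _ _ u v `|u|
    (2 `^ p^-1 * `|u| - 2 * `|m|) c0 EF q2 uE vE erefl (esym uv).
  rewrite !lerBlDr => /(_ h1 h2) h.
  by rewrite mulrAC ler_pdivlMr//; lra.
- have two0 : (0 : R) < 2 by [].
  have [eps [eps0 lt]] := exists_dilation_lt (powR_gt0 p^-1 (ltr0n R 2))
    (pow2_lt _ _ two0 p2).
  exists eps; split=> // E F EF.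
  have c0 : 0 <= 1 + eps by lra.
  have D0 : 0 < 2 `^ 2^-1 - (1 + eps) * 2 `^ p^-1 by rewrite subr_gt0.
  apply: (@stable_phase_retrieval_of_disjoint _ _ _ _ _ _ _
    ((1 + eps) / (2 `^ 2^-1 - (1 + eps) * 2 `^ p^-1))).
    by rewrite divr_ge0// ltW.
  move=> u v m uE vE uv uvm.
  have uvm' := ae_min_norm_oppr uvm.
  have h1 := almost_disjoint_le uvm; have h2 := almost_disjoint_le uvm'.
  rewrite normrN -uv root2// in h2; rewrite -uv root2// in h1.
  have := c_isomorphic_parallelogram c0 EF q2 uE vE erefl (esym uv) h1 h2.
  rewrite q2 => h.
  by rewrite mulrAC ler_pdivlMr//; lra.
Qed.
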